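(* Let $K$ be a field, $S=K[x_1,\ldots,x_n]$, and let $I\subset S$ be a monomial ideal with linear quotients with respect to the admissible order $\sigma$ of $G(I)$. Let $\sigma'$ be the degree increasing admissible order of $G(I)$ induced by $\sigma$. Then for all $u\in G(I)$ we have $$q_{u,\sigma}(I)=q_{u,\sigma'}(I).$$
   Context: For a monomial ideal $I$, $G(I)$ denotes its unique minimal set of monomial generators. An ordering $\sigma=u_1,\ldots,u_m$ of $G(I)$ is called an admissible order if for each $i=2,\ldots,m$ the colon ideal $(u_1,\ldots,u_{i-1}):u_i$ is generated by a subset of the variables $\{x_1,\ldots,x_n\}$. $I$ has linear quotients if $G(I)$ has an admissible order. For an admissible order $\sigma=u_1,\ldots,u_m$, $q_{u_j,\sigma}(I)\subset\{x_1,\ldots,x_n\}$ denotes the set of minimal monomial generators of $(u_1,\ldots,u_{j-1}):u_j$ (empty for $j=1$). The degree increasing order $\sigma'$ induced by $\sigma$ is obtained by stably sorting $\sigma$ by degree: $u$ comes before $v$ in $\sigma'$ if and only if $\deg u<\deg v$, or $\deg u=\deg v$ and $u$ comes before $v$ in $\sigma$. (The order $\sigma'$ is again an admissible order of $G(I)$.) *)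

(* Defs.v *)
From HB Require Import structures.
From mathcomp Require Import all_boot all_order all_algebra.
From mathcomp.multinomials Require Import mpoly.
From Stdlib Require Import Classical.

Set Implicit Arguments.
Unset Strict Implicit.
Unset Printing Implicit Defensive.

Import GRing.Theory.
Local Open Scope ring_scope.

(* Ideals are Prop-valued predicates: the ideals of ring_quotient are boolean
   and proper, whereas neither decidability nor properness is assumed here. *)
Section Ideals.
Variable S : comNzRingType.
Implicit Types (A I : S -> Prop) (u f : S).

Definition is_ideal I : Prop :=
  [/\ I 0,
      forall f g, I f -> I g -> I (f + g)
    & forall f g, I g -> I (f * g)].

Definition ideal_gen A : S -> Prop :=
  fun f => forall J, is_ideal J -> (forall a, A a -> J a) -> J f.

Definition colon I u : S -> Prop := fun f => I (f * u).

End Ideals.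

Section MonomialIdeals.
Variables (K : fieldType) (n : nat).
Implicit Types (M G : 'X_{1..n} -> Prop) (I : {mpoly K[n]} -> Prop).
Implicit Types (s : seq 'X_{1..n}) (u v m : 'X_{1..n}).

(* Monomials of K[x_1,...,x_n] are represented by their exponent vectors. *)
Definition monideal M : {mpoly K[n]} -> Prop :=
  ideal_gen (fun f => exists2 m, M m & f = 'X_[m]).

Definition generates M I : Prop := forall f, I f <-> monideal M f.

Definition monomial_ideal I : Prop := exists M, generates M I.

Definition is_min_generators G I : Prop :=
  generates G I /\
  forall M, (forall m, M m -> G m) -> generates M I -> forall m, G m -> M m.

(* G(I); is_min_generatorsP and is_min_generators_uniq below show that a
   monomial ideal has exactly one minimal set of monomial generators, and that
   it is the set min_generators I. *)
Definition min_generators I : 'X_{1..n} -> Prop :=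
  fun m => exists2 G, is_min_generators G I & G m.

Definition prefix_ideal s u : {mpoly K[n]} -> Prop :=
  monideal (fun v => v \in take (index u s) s).

Definition prefix_colon s u : {mpoly K[n]} -> Prop :=
  colon (prefix_ideal s u) 'X_[u].

Definition generated_by_variables I : Prop :=
  exists V : {set 'I_n}, generates (fun m => exists2 i, i \in V & m = U_(i)%MM) I.

Definition orders_min_generators I s : Prop :=
  uniq s /\ forall m, m \in s <-> min_generators I m.

Definition admissible_order I s : Prop :=
  orders_min_generators I s /\
  forall i, (0 < i < size s)%N ->
    generated_by_variables (prefix_colon s (nth 0%MM s i)).

Definition colon_vars s u : 'X_{1..n} -> Prop :=
  min_generators (prefix_colon s u).

End MonomialIdeals.

(* MathComp's sort is stable; see degree_increasing_before. *)
Definition degree_increasing n (s : seq 'X_{1..n}) : seq 'X_{1..n} :=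
  sort (fun u v => (mdeg u <= mdeg v)%N) s.

Lemma degree_increasing_before n (s : seq 'X_{1..n}) u v :
    uniq s -> u \in s -> v \in s ->
  (index u (degree_increasing s) < index v (degree_increasing s))%N =
    (mdeg u < mdeg v)%N || (mdeg u == mdeg v) && (index u s < index v s)%N.
Proof.
move=> Us us vs; rewrite /degree_increasing; set le := fun _ _ => _.
set lex : rel 'X_{1..n} := fun u v =>
  (mdeg u < mdeg v)%N || (mdeg u == mdeg v) && (index u s < index v s)%N.
have lex_tr : transitive lex.
  move=> y x z /orP[xy|/andP[/eqP xy ixy]] /orP[yz|/andP[/eqP yz iyz]].
  - by rewrite /lex (ltn_trans xy yz).
  - by rewrite /lex -yz xy.
  - by rewrite /lex xy yz.
  by rewrite /lex xy yz eqxx (ltn_trans ixy iyz) orbT.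
have lex_irr : irreflexive lex by move=> x; rewrite /lex !ltnn andbF.
have le_tot : total le by move=> x y; apply: leq_total.
have so : sorted lex (sort le s).
  have := @sort_pairwise_stable _ le (fun u v => index u s < index v s)%N le_tot s.
  have -> : pairwise (fun u v => index u s < index v s)%N s.
    apply/(pairwiseP 0%MM) => i j si sj ij.
    by rewrite !index_uniq.
  move=> /(_ isT); apply: sub_sorted => x y /andP[].
  by rewrite /lex /le /=; case: (ltngtP (mdeg x)).
have lt_lex x y : x \in s -> y \in s ->
    (index x (sort le s) < index y (sort le s))%N -> lex x y.
  by move=> xs ys; apply: (sorted_ltn_index lex_tr so); rewrite mem_sort.
have [|le_vu] := ltnP; first by move/(lt_lex u v us vs).
apply/esym/negP => uv; move: le_vu; rewrite leq_eqVlt => /orP[/eqP E|].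
  have := congr1 (nth 0%MM (sort le s)) E.
  rewrite !nth_index ?mem_sort // => E'.
  by move: uv; rewrite -/(lex u v) E' lex_irr.
move/(lt_lex v u vs us) => vu; have := lex_tr _ _ _ uv vu.
by rewrite lex_irr.
Qed.

Section MinGenerators.
Variables (K : fieldType) (n : nat).
Implicit Types (M G H : 'X_{1..n} -> Prop) (I : {mpoly K[n]} -> Prop).

Lemma monideal_mon M m :
  monideal M ('X_[m] : {mpoly K[n]}) <-> exists2 v, M v & (v <= m)%MM.
Proof.
split=> [Mm|[v Mv le_vm] J [_ _ JM] MJ]; last first.
  by rewrite -(submK le_vm) mpolyXD; apply/JM/MJ; exists v.
pose J (f : {mpoly K[n]}) :=
  forall m, m \in msupp f -> exists2 v, M v & (v <= m)%MM.
apply: (Mm J); last by rewrite msuppX inE.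
  split=> [k|f g Jf Jg k|f g Jg k].
  - by rewrite msupp0.
  - by move/msuppD_le; rewrite mem_cat => /orP[/Jf|/Jg].
  move/msuppM_le => /allpairsP[[a b] /= [_ /Jg[v Mv vb] ->]]; exists v => //.
  exact/(lepm_trans vb)/lem_addl.
move=> _ [v Mv ->] k; rewrite msuppX inE => /eqP ->; exists v => //.
exact: lepm_refl.
Qed.

Lemma monideal_sub M H :
    (forall m, M m -> exists2 v, H v & (v <= m)%MM) ->
  forall f : {mpoly K[n]}, monideal M f -> monideal H f.
Proof.
move=> MH f Mf; apply: Mf => [|_ [m /MH/monideal_mon Hm ->]] //.
split=> [J [] //|a b Ha Hb J JI HJ|a b Hb J JI HJ]; case: (JI) => _ JD JM.
  by apply: JD; [apply: Ha | apply: Hb].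
by apply: JM; apply: Hb.
Qed.

Lemma is_min_generators_uniq G H I :
  is_min_generators G I -> is_min_generators H I -> forall m, G m <-> H m.
Proof.
have sub : forall G H, is_min_generators G I -> is_min_generators H I ->
    forall m, G m -> H m.
  move=> {}G {}H [GI minG] [HI _] m Gm.
  have /GI/HI/monideal_mon[h Hh hm] : monideal G ('X_[m] : {mpoly K[n]}).
    by apply/monideal_mon; exists m; rewrite ?lepm_refl.
  have /HI/GI/monideal_mon[g Gg gh] : monideal H ('X_[h] : {mpoly K[n]}).
    by apply/monideal_mon; exists h; rewrite ?lepm_refl.
  have gm := lepm_trans gh hm.
  have [E|g_m] := eqVneq g m.
    suff -> : m = h by [].
    apply/mnmP => i; apply/eqP; rewrite eqn_leq -{1}E.
    by rewrite (mnm_lepP gh) (mnm_lepP hm).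
  suff [] : G m /\ m <> m by [].
  apply: (minG (fun k => G k /\ k <> m)) Gm => [k []|f] //.
  rewrite GI; split; apply: monideal_sub => k.
    move=> Gk; have [->|/eqP km] := eqVneq k m; last first.
      by exists k; rewrite ?lepm_refl.
    by exists g => //; split=> //; apply/eqP.
  by case=> Gk _; exists k; rewrite ?lepm_refl.
by move=> mG mH m; split; apply: sub.
Qed.

Lemma is_min_generatorsP I :
  monomial_ideal I -> is_min_generators (min_generators I) I.
Proof.
case=> M MI.
suff [G mG] : exists G, is_min_generators G I.
  have E m : min_generators I m <-> G m.
    split=> [[H mH Hm]|Gm]; last by exists G.
    exact/(is_min_generators_uniq mH mG).
  case: mG => GI minG; split=> [f|H HG HI m /E Gm].
    rewrite GI; split; apply: monideal_sub => k /E Ek; exists k => //;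
      exact: lepm_refl.
  by apply: (minG H) => // k /HG/E.
pose G m := M m /\ forall v, M v -> (v <= m)%MM -> v = m.
have MG m : M m -> exists2 v, G v & (v <= m)%MM.
  have [d] := ubnP (mdeg m); elim: d m => // d IH m /ltnSE md Mm.
  case: (classic (G m)) => [Gm|nGm]; first by exists m; rewrite ?lepm_refl.
  have [v [Mv vm v_m]] : exists v, [/\ M v, (v <= m)%MM & v <> m].
    apply: NNPP => no; apply: nGm; split=> // v Mv vm.
    by apply: NNPP => v_m; apply: no; exists v.
  have [||w Gw wv] := IH v => //; last by exists w => //; apply: lepm_trans vm.
  apply: leq_trans md; rewrite -(submK vm) mdegD -{1}[mdeg v]add0n ltn_add2r.
  rewrite lt0n mdeg_eq0; apply/eqP => mv0.
  by apply: v_m; rewrite -(submK vm) mv0 add0m.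
exists G; split=> [f|H HG HI m Gm].
  rewrite MI; split; apply: monideal_sub => // k [Mk _].
  by exists k; rewrite ?lepm_refl.
have [Mm minm] := Gm.
have /MI/HI/monideal_mon[h Hh hm] : monideal M ('X_[m] : {mpoly K[n]}).
  by apply/monideal_mon; exists m; rewrite ?lepm_refl.
by rewrite -(minm h) //; case: (HG _ Hh).
Qed.

End MinGenerators.

(* Main.v *)
Require Import Defs.
From mathcomp Require Import all_boot all_order all_algebra.
From mathcomp.multinomials Require Import mpoly.

(** If [v] precedes [u] in an admissible order, some variable [x_i] of the colon
ideal at [u] divides [v : u]; it is of the form [w : u] with [w] preceding [u],
and [deg w <= deg u] since otherwise [w = x_i u] would not be a minimal
generator. Hence [w] divides [lcm(u, v)] and precedes [u] in the degree
increasing order as well. Conversely, if [v] follows [u] but [deg v < deg u],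
the same argument at [v] yields [w] preceding [v] with [deg w < deg u] and [w]
dividing [lcm(u, v)]; iterating, one reaches a generator preceding [u]. Both
colon ideals at [u] therefore coincide. *)

Set Implicit Arguments.
Unset Strict Implicit.
Unset Printing Implicit Defensive.

Import GRing.Theory.
Local Open Scope ring_scope.

Section MonomialIdealMembership.
Variables (K : fieldType) (n : nat).
Implicit Types (M G : 'X_{1..n} -> Prop) (I J : {mpoly K[n]} -> Prop).
Implicit Types (s : seq 'X_{1..n}) (u v m : 'X_{1..n}).

Lemma is_ideal_monideal M : is_ideal (@monideal K n M).
Proof.
split=> [J [] //|f g Mf Mg J idJ MJ|f g Mg J idJ MJ]; have [_ JD JM] := idJ.
  by apply: JD; [apply: Mf | apply: Mg].
by apply: JM; apply: Mg.
Qed.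

(** The polynomials satisfying the support condition form an ideal containing [M]; conversely, such
    an [f] is the sum of its terms, each a multiple of some element of [M]. *)
Lemma monidealP M (f : {mpoly K[n]}) :
  monideal M f <->
  forall m, m \in msupp f -> exists2 v, M v & (v <= m)%MM.
Proof.
split=> [Mf|Mf].
  apply: (Mf (fun f => forall m, m \in msupp f ->
    exists2 v, M v & (v <= m)%MM)) => [|_ [m Mm ->] k]; last first.
    by rewrite msuppX inE => /eqP ->; exists m => //; apply: lepm_refl.
  split=> [m|g h Mg Mh m|g h Mh m]; first by rewrite msupp0.
    by move/msuppD_le; rewrite mem_cat => /orP[/Mg|/Mh].
  move/msuppM_le => /allpairsP[[a b] /= [_ /Mh[v Mv vb] ->]]; exists v => //.
  exact/(lepm_trans vb)/lem_addl.
have [M0 MD MM] := is_ideal_monideal M.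
rewrite (mpolyE f) big_seq; elim/big_rec: _ => // m g m_f Mg.
by apply: MD => //; rewrite -mul_mpolyC; apply: MM; exact/monideal_mon/Mf.
Qed.

(** Were [u] and [v] distinct, [v] could be dropped from the generators, [u] taking its place,
    against minimality. *)
Lemma min_generators_antichain I u v :
  monomial_ideal I -> min_generators I u -> min_generators I v ->
  (u <= v)%MM -> u = v.
Proof.
move=> /is_min_generatorsP[GI minG] Gu Gv le_uv.
have [//|/eqP uv] := eqVneq u v.
pose H m := min_generators I m /\ m <> v.
suff /(minG H)-/(_ _ v Gv)[] : generates H I by [|move=> m []].
move=> f; rewrite GI; split; apply: monideal_sub => m; last first.
  by case=> Gm _; exists m => //; apply: lepm_refl.
move=> Gm; have [->|/eqP mv] := eqVneq m v; first by exists u.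
by exists m => //; apply: lepm_refl.
Qed.

Lemma eq_min_generators I J :
  (forall f, I f <-> J f) -> forall m, min_generators I m -> min_generators J m.
Proof.
move=> IJ m [G [GI minG] Gm]; exists G => //; split=> [f|M MG MJ].
  by rewrite -IJ.
by apply: minG => // f; rewrite IJ.
Qed.

(** Multiplying by ['X_[u]] shifts the support by [u]. The strict inequality of indices also forces
    [v \in s], since absent elements have index [size s]. *)
Lemma prefix_colonP s u (f : {mpoly K[n]}) :
  prefix_colon s u f <->
  forall m, m \in msupp f ->
    exists2 v, (index v s < index u s)%N & (v <= u + m)%MM.
Proof.
have prefE v : (v \in take (index u s) s) = (index v s < index u s)%N.
  by rewrite in_take_leq ?index_size.
rewrite /prefix_colon /colon /prefix_ideal monidealP; split=> Hf m.
  move=> mf; have [|v] := Hf (u + m)%MM; last by rewrite prefE; exists v.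
  by rewrite (perm_mem (msuppMX f u)) map_f.
rewrite (perm_mem (msuppMX f u)) => /mapP[k /Hf[v vu vk] ->].
by exists v; rewrite ?prefE.
Qed.

Lemma prefix_colonX s u m :
  @prefix_colon K n s u 'X_[m] <->
  exists2 v, (index v s < index u s)%N & (v <= u + m)%MM.
Proof.
rewrite prefix_colonP; split=> [|ex k]; first by apply; rewrite msuppX inE.
by rewrite msuppX inE => /eqP ->.
Qed.

(** A common multiple of [u] and [v] is a multiple of their lcm, hence of [w]. *)
Lemma prefix_colon_sub s s' u :
  (forall v, (index v s < index u s)%N ->
    exists2 w, (index w s' < index u s')%N & (w <= mlcm u v)%MM) ->
  forall f, @prefix_colon K n s u f -> prefix_colon s' u f.
Proof.
move=> ss' f /prefix_colonP sf; apply/prefix_colonP => m /sf[v /ss'[w wu w_le]].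
move=> v_le; exists w => //; apply: lepm_trans w_le _.
by rewrite lem_mlcm lem_addr.
Qed.

End MonomialIdealMembership.

Section AdmissibleOrder.
Variables (K : fieldType) (n : nat) (I : {mpoly K[n]} -> Prop).
Variable s : seq 'X_{1..n}.
Hypotheses (monI : monomial_ideal I) (adm : admissible_order I s).
Implicit Types u v w : 'X_{1..n}.

Lemma admissible_order_lcm u v :
    u \in s -> (index v s < index u s)%N ->
  exists w, [/\ (index w s < index u s)%N, (mdeg w <= mdeg u)%N
              & (w <= mlcm u v)%MM].
Proof.
have [[_ memG] varG] := adm; move=> us vu.
have [|V genV] := varG (index u s).
  by rewrite index_mem us (leq_ltn_trans _ vu).
rewrite nth_index // in genV.
(* Subtraction of exponents is truncated, so [v - u] is the exponent of [v : u], and [u + (v - u)]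
   is the lcm. *)
have /genV/monideal_mon[_ [i iV ->] i_vu] :
    @prefix_colon K n s u 'X_[(v - u)%MM].
  by apply/prefix_colonX; exists v; rewrite // -mlcmE lem_mlcmr.
have /genV/prefix_colonX[w wu w_le] :
    @monideal K n (fun m => exists2 i, i \in V & m = U_(i)%MM) 'X_[U_(i)%MM].
  by apply/monideal_mon; exists U_(i)%MM; [exists i | apply: lepm_refl].
exists w; split=> //; last first.
  apply: lepm_trans w_le _; rewrite mlcmE.
  by apply/mnm_lepP => j; rewrite !mnmDE leq_add2l (mnm_lepP i_vu).
rewrite leqNgt; apply/negP => deg_uw.
have ws : w \in s.
  by rewrite -index_mem (leq_trans wu) // index_size.
(* The multiple [u + U_(i)] of [w] has degree [mdeg u + 1], at most that of [w], so the quotient is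
   trivial. *)
have /eqP : mdeg (u + U_(i) - w)%MM = 0%N.
  apply/eqP; rewrite -leqn0 -(leq_add2r (mdeg w)) -mdegD submK //.
  by rewrite mdegD mdeg1 addn1.
rewrite mdeg_eq0 => /eqP uiw; have Ew := submK w_le.
rewrite uiw add0m in Ew.
suff E : u = w by rewrite E ltnn in wu.
apply: (min_generators_antichain monI); [exact/memG|exact/memG|].
by rewrite Ew lem_addr.
Qed.

Lemma admissible_order_lower_deg_lcm u v :
    u \in s -> v \in s -> (mdeg v < mdeg u)%N ->
  exists2 w, (index w s < index u s)%N & (w <= mlcm u v)%MM.
Proof.
(* Induction on the position of [v], which drops strictly at each replacement, whereas the degree
   may stay the same. *)
move=> us; have [d] := ubnP (index v s); elim: d v => // d IH v /ltnSE vd vs vu.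
have [lt_vu|uv|E] := ltngtP (index v s) (index u s).
- by exists v; rewrite ?lem_mlcmr.
- have [w [wv deg_wv w_le]] := admissible_order_lcm vs uv.
  have ws : w \in s by rewrite -index_mem (leq_trans wv) // index_size.
  have [w' w'u w'_le] := IH w (leq_trans wv vd) ws (leq_ltn_trans deg_wv vu).
  exists w' => //; apply: lepm_trans w'_le _.
  by rewrite lem_mlcm lem_mlcml mlcmC.
- by move: vu; rewrite -(nth_index 0%MM vs) E nth_index // ltnn.
Qed.

Lemma prefix_colon_degree_increasing u f :
  u \in s ->
  prefix_colon s u f <-> @prefix_colon K n (degree_increasing s) u f.
Proof.
have [[Us _] _] := adm; move=> us.
split; apply: prefix_colon_sub => v vu.
  have [w [wu deg_wu w_le]] := admissible_order_lcm us vu.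
  have ws : w \in s by rewrite -index_mem (leq_trans wu) // index_size.
  exists w => //; rewrite degree_increasing_before //.
  by rewrite wu andbT orbC -leq_eqVlt.
have vs : v \in s.
  rewrite -(mem_sort (fun u v => (mdeg u <= mdeg v)%N)) -index_mem.
  by rewrite (leq_trans vu) // index_size.
(* Only a [v] of smaller degree may follow [u] in [s]; on equal degrees the sort keeps the order of
   [s]. *)
move: vu; rewrite degree_increasing_before // => /orP[deg_vu|/andP[_ vu]].
  exact: admissible_order_lower_deg_lcm.
by exists v; rewrite ?lem_mlcmr.
Qed.

End AdmissibleOrder.

Theorem proposition2p2 (K : fieldType) (n : nat) (I : {mpoly K[n]} -> Prop)
    (sigma : seq 'X_{1..n}) (I_monomial : monomial_ideal I)
    (sigma_admissible : admissible_order I sigma) :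
  forall u : 'X_{1..n}, min_generators I u ->
    forall x : 'X_{1..n},
      colon_vars K sigma u x <-> colon_vars K (degree_increasing sigma) u x.
Proof.
have [[_ memG] _] := sigma_admissible.
move=> u /memG us x.
have E f := prefix_colon_degree_increasing I_monomial sigma_admissible f us.
by split; apply: eq_min_generators => f; rewrite E.
Qed.
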